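(* Let $\mathscr{N}\subset\mathbb{Z}$ have positive forward density. Then for every $\epsilon>0$, every $k\in\mathbb{N}$ and every set $\mathcal{Q}$ of $k$ integers, there exists $N\in\mathbb{N}$ such that, for all $n\geq N$, there is an $n$-scale of $\mathcal{Q}$ $\epsilon$-contained in $\mathscr{N}$.
   Context: Here $\mathbb{N}=\{1,2,3,\dots\}$. A set $\mathscr{N}\subset\mathbb{Z}$ has positive forward density if the limit $$\Delta^+(\mathscr{N}):=\lim_{n\to+\infty}\frac{1}{n+1}\#\{0\leq i\leq n\colon i\in\mathscr{N}\}$$ exists and is positive, where $\#$ denotes cardinality. Let $k\in\mathbb{N}$, let $\mathcal{Q}=\{q_1,q_2,\dots,q_k\}\subset\mathbb{Z}$ with $q_1<q_2<\dots<q_k$, let $n\in\mathbb{N}$ with $n\geq k$, let $\epsilon>0$, and let $\mathscr{N}\subset\mathbb{Z}$. An $n$-scale of $\mathcal{Q}$ $\epsilon$-contained in $\mathscr{N}$ is a set $\{r_1,r_2,\dots,r_k\}\subset\mathscr{N}$ with $k$ elements (so the $r_i$ are pairwise distinct) such that $$|r_i-\tau_i|<n\epsilon\quad\text{for all } i=1,\dots,k,$$ where $\tau_1=0$ and, if $k>1$, $\tau_i=\frac{q_i-q_1}{q_k-q_1}\,n$ for $i=2,\dots,k$ (in particular $\tau_k=n$). *)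

(* Defs.v *)
From mathcomp Require Import all_boot all_order all_algebra finmap.
From mathcomp Require Import all_classical all_reals all_analysis.
Import Order.TTheory GRing.Theory Num.Theory.
Import numFieldNormedType.Exports.

Set Implicit Arguments.
Unset Strict Implicit.
Unset Printing Implicit Defensive.

Local Open Scope classical_set_scope.
Local Open Scope ring_scope.

Definition forward_count (A : set int) (n : nat) : nat :=
  #|[pred i : 'I_n.+1 | (i : nat)%:Z \in A]|.

Definition forward_freq (R : realType) (A : set int) (n : nat) : R :=
  (forward_count A n)%:R / n.+1%:R.

Definition positive_forward_density (R : realType) (A : set int) : Prop :=
  cvgn (@forward_freq R A) /\ 0 < limn (@forward_freq R A).

(* [elt Q i] is q_(i+1), where q_1 < ... < q_k are the elements of Q: indices
   are shifted down by one, here and below. *)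
Definition elt (Q : {fset int}) (i : nat) : int :=
  nth 0 (sort <=%O (enum_fset Q)) i.

Definition tau (R : realType) (Q : {fset int}) (n i : nat) : R :=
  if i == 0%N then 0
  else (elt Q i - elt Q 0)%:~R / (elt Q (#|` Q|).-1 - elt Q 0)%:~R * n%:R.

(* Scales are defined only for n >= k = #|` Q|; this is why the condition is
   part of the predicate. *)
Definition scale_contained (R : realType) (Q : {fset int}) (n : nat) (eps : R)
    (A : set int) (S : {fset int}) : Prop :=
  [/\ (#|` Q| <= n)%N,
      #|` S| = #|` Q|,
      [set` S] `<=` A
    & exists r : 'I_(#|` Q|) -> int,
        S = [fset r i | i : 'I_(#|` Q|)]%fset /\
        forall i : 'I_(#|` Q|), `|(r i)%:~R - tau R Q n i| < n%:R * eps].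

(* Main.v *)
(* Positive forward density leaves no gap of length proportional to n in [0, n],
   so for large n every tau_i has an element r_i of A within n * delta. The tau_i
   are at distance at least n / (q_k - q_1) from each other, so for small delta
   the r_i are pairwise distinct. *)
Require Import Defs.
From mathcomp Require Import all_boot all_order all_algebra finmap.
From mathcomp Require Import all_classical all_reals all_analysis.
From mathcomp Require Import lra zify.
Import Order.TTheory GRing.Theory Num.Theory.
Import numFieldNormedType.Exports.
Local Open Scope classical_set_scope.
Local Open Scope ring_scope.

Lemma forward_countE (A : set int) (n : nat) :
  forward_count A n = (\sum_(i < n.+1) ((i : nat)%:Z \in A))%N.
Proof.
rewrite /forward_count -sum1_card big_mkcond /=.
by apply: eq_bigr => i _; rewrite inE; case: (_ \in A).
Qed.

Lemma forward_countS (A : set int) (n : nat) :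
  forward_count A n.+1 = (forward_count A n + (n.+1%:Z \in A))%N.
Proof. by rewrite !forward_countE big_ord_recr. Qed.

Lemma forward_count_le (A : set int) (n : nat) : (forward_count A n <= n.+1)%N.
Proof. by rewrite (leq_trans (max_card _)) ?card_ord. Qed.

(** Each increment of the count is witnessed by the integer just added, so comparing two counts
    suffices to exhibit an element of [A]. *)
Lemma forward_count_gap (A : set int) (m p : nat) :
  (forward_count A m < forward_count A (m + p))%N ->
  exists2 i : nat, (m < i <= m + p)%N & A i%:Z.
Proof.
elim: p => [|p IHp]; first by rewrite addn0 ltnn.
rewrite addnS forward_countS.
have [iA _|_] := boolP ((m + p).+1%:Z \in A).
  by exists (m + p).+1; [lia|exact: set_mem].
by rewrite addn0 => /IHp[i mi Ai]; exists i => //; lia.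
Qed.

(* If [A] missed ]m, m + p], then (d - e) (m + p + 1) <= count (m + p) = count m
   <= (d + e) (m + 1) up to a bounded error, so p = O(e n): the density limit
   allows no gap of length proportional to n. *)
Lemma density_hit (R : realType) (A : set int) (delta : R) :
  positive_forward_density R A -> 0 < delta ->
  exists2 N : nat, (0 < N)%N & forall n : nat, (N <= n)%N ->
    forall x : R, 0 <= x <= n%:R ->
    exists2 a : int, A a & `|a%:~R - x| < n%:R * delta.
Proof.
move=> [cvgA d_gt0] delta_gt0; set d := limn _ in d_gt0.
(* The bound [1/2] keeps [d - d * c] at least [d / 2]; the bound [delta / 64] makes the error
   [2 * d * c] per integer negligible over all of [[0, n]]. *)
pose c : R := Num.min (1/2) (delta / 64).
have c_gt0 : 0 < c by rewrite lt_min; apply/andP; split; lra.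
have c_le2 : c <= 1/2 by rewrite ge_min lexx.
have c_le : c <= delta / 64 by rewrite ge_min lexx orbT.
have dc_gt0 : 0 < d * c by rewrite mulr_gt0.
have := cvgA => /cvgrPdist_lt /(_ _ dc_gt0) [M _ Mfreq].
have Mcount j : (M <= j)%N ->
    j.+1%:R * (d - d * c) < (forward_count A j)%:R :> R /\
    (forward_count A j)%:R < j.+1%:R * (d + d * c) :> R.
  move=> /Mfreq /=; rewrite -/d distrC ltr_distl => /andP[].
  by rewrite /forward_freq ltr_pdivlMr// ltr_pdivrMr// ![_ * j.+1%:R]mulrC.
(* The upper bound is needed at the integer part of [x], which may lie below [M]; there the count is
   at most [M]. *)
have Mcount_le j : (forward_count A j)%:R <= j.+1%:R * (d + d * c) + M%:R :> R.
  have [/Mcount[_]|jM] := leqP M j.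
    by move=> hi; apply: le_trans (ltW hi) _; rewrite lerDl.
  have : (forward_count A j)%:R <= M%:R :> R.
    by rewrite ler_nat (leq_trans (forward_count_le _ _)).
  have : 0 <= j.+1%:R * (d + d * c) by apply: mulr_ge0 => //; lra.
  lra.
(* The first term makes the window longer than [M] ([n1]); the second absorbs the additive error [M]
   ([n2]). *)
pose B : R := 4 * (M%:R + 1) / delta + 16 * (M%:R + 1) / (d * delta).
exists (Num.truncn B).+1 => // n Bn x /andP[x_ge0 x_le].
have n_ge1 : 1 <= n%:R :> R by rewrite ler1n; lia.
have ltBn : B < n%:R.
  by rewrite (lt_le_trans (truncnS_gt B))// ler_nat.
have M1 : 1 <= M%:R + 1 :> R by rewrite lerDr.
have n1 : 4 * (M%:R + 1) < n%:R * delta.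
  rewrite -ltr_pdivrMr//; apply: le_lt_trans ltBn; rewrite lerDl.
  by rewrite divr_ge0 ?mulr_ge0//; lra.
have n2 : 16 * (M%:R + 1) < n%:R * (d * delta).
  rewrite -ltr_pdivrMr ?mulr_gt0//; apply: le_lt_trans ltBn; rewrite lerDr.
  by rewrite divr_ge0 ?mulr_ge0//; lra.
(* With [m] the integer part of [x], any [i] in []m, m + p]] satisfies
   [x < i <= x + n * delta / 2]. *)
pose p := Num.truncn (n%:R * delta / 2).
have nd_ge0 : 0 <= n%:R * delta / 2 by lra.
have p_le : p%:R <= n%:R * delta / 2 by rewrite truncn_le.
have p_gt : n%:R * delta / 2 < p%:R + 1 by rewrite natr1 truncnS_gt.
pose m := Num.truncn x.
have m_le : m%:R <= x by rewrite truncn_le.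
have m_gt : x < m%:R + 1 by rewrite natr1 truncnS_gt.
have p_ge : n%:R * delta / 4 <= p%:R by lra.
have Mp : (M <= m + p)%N.
  by rewrite (leq_trans _ (leq_addl _ _))// -(ler_nat R); lra.
have /forward_count_gap[i /andP[mi ip] Ai] :
    (forward_count A m < forward_count A (m + p))%N.
  rewrite -(ltr_nat R); apply: le_lt_trans (Mcount_le m) _.
  (* The window contributes at least [n * d * delta / 8] ([dp]), the density error costs at most
     half of that ([dm]), and [n2] leaves room for [M]. *)
  apply: lt_trans (Mcount _ Mp).1.
  have dp : n%:R * (d * delta) / 8 <= p%:R * (d - d * c).
    have h1 := ler_wpM2r (ltW d_gt0) p_ge.
    have h2 : 0 <= p%:R * d * (1/2 - c) by rewrite !mulr_ge0//; lra.
    lra.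
  have dm : (m%:R + 1) * (2 * (d * c)) <= n%:R * (d * delta) / 16.
    have h1 : (m%:R + 1) * (2 * (d * c)) <= (2 * n%:R) * (2 * (d * c)).
      by rewrite ler_wpM2r//; lra.
    have h2 : n%:R * (d * c) <= n%:R * (d * (delta / 64)).
      by rewrite !ler_wpM2l//; lra.
    lra.
  rewrite -!natr1 natrD; lra.
exists i%:Z => //; rewrite -pmulrn.
have : m%:R + 1 <= i%:R :> R by rewrite natr1 ler_nat.
have : i%:R <= m%:R + p%:R :> R by rewrite -natrD ler_nat.
move=> ip' mi'; rewrite ger0_norm; lra.
Qed.

Lemma elt_mono (Q : {fset int}) (i j : nat) :
  (j < #|` Q|)%N -> (i < j)%N -> elt Q i < elt Q j.
Proof.
move=> jQ ij; rewrite /elt.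
have sQ : sorted <%O (sort <=%O (enum_fset Q)).
  by rewrite sort_lt_sorted fset_uniq.
by apply: (sorted_ltn_nth lt_trans) => //; rewrite inE size_sort ?(ltn_trans ij).
Qed.

Lemma elt_le (Q : {fset int}) (i j : nat) :
  (j < #|` Q|)%N -> (i <= j)%N -> elt Q i <= elt Q j.
Proof.
by move=> jQ; rewrite leq_eqVlt => /predU1P[->//|/(elt_mono _ _ _ jQ)/ltW].
Qed.

Lemma tauE (R : realType) (Q : {fset int}) (n i : nat) :
  tau R Q n i =
  (elt Q i - elt Q 0)%:~R / (elt Q (#|` Q|).-1 - elt Q 0)%:~R * n%:R.
Proof. by rewrite /tau; case: eqP => // ->; rewrite subrr !mul0r. Qed.

Lemma tau_bound (R : realType) (Q : {fset int}) (n i : nat) :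
  (i < #|` Q|)%N -> 0 <= tau R Q n i <= n%:R.
Proof.
move=> iQ; rewrite tauE.
have i0 : 0 <= elt Q i - elt Q 0 by rewrite subr_ge0 elt_le.
have ik : elt Q i <= elt Q (#|` Q|).-1 by apply: elt_le; lia.
have D_ge0 : 0 <= elt Q (#|` Q|).-1 - elt Q 0 by lia.
apply/andP; split; first by rewrite mulr_ge0// divr_ge0 ?ler0z.
(* For a singleton the denominator is 0, and the convention [0^-1 = 0] makes the quotient 0. *)
rewrite ler_piMl//; have [->|D0] := eqVneq (elt Q (#|` Q|).-1 - elt Q 0) 0.
  by rewrite invr0 mulr0.
by rewrite ler_pdivrMr ?mul1r ?ler_int ?ltr0z; lia.
Qed.

(** Distinct integers differ by at least 1, and [tau] rescales differences by the left-hand side. *)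
Lemma tau_sep (R : realType) (Q : {fset int}) (n i j : nat) :
  (j < #|` Q|)%N -> (i < j)%N ->
  n%:R / (elt Q (#|` Q|).-1 - elt Q 0)%:~R <= tau R Q n j - tau R Q n i.
Proof.
move=> jQ ij; rewrite !tauE -!mulrBl -rmorphB /=.
have jk : elt Q j <= elt Q (#|` Q|).-1 by apply: elt_le; lia.
have ji := elt_mono _ _ _ jQ ij.
have i0 : elt Q 0 <= elt Q i by apply: elt_le; lia.
rewrite mulrC ler_wpM2r// ler_peMl ?invr_ge0 ?ler0z ?ler1z//; last by lia.
by rewrite subr_ge0 (le_trans i0)// (le_trans (ltW ji)).
Qed.

Theorem theorem1 (R : realType) (A : set int)
    (hA : positive_forward_density R A) (eps : R) (heps : 0 < eps)
    (k : nat) (hk : (0 < k)%N) (Q : {fset int}) (hQ : #|` Q| = k) :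
  exists2 N : nat, (0 < N)%N &
    forall n : nat, (N <= n)%N ->
      exists S : {fset int}, scale_contained Q n eps A S.
Proof.
pose D : int := elt Q (#|` Q|).-1 - elt Q 0.
have D_ge0 : 0 <= D by rewrite subr_ge0 elt_le; lia.
have D1_gt0 : 0 < (D%:~R + 1) * 2 :> R.
  by rewrite mulr_gt0// ltr_wpDl ?ler0z.
(* With 2 delta <= 1 / (D + 1), the neighbourhoods of the [tau i] are disjoint;
   D + 1 keeps delta positive when Q is a singleton. *)
pose delta : R := Num.min eps ((D%:~R + 1) * 2)^-1.
have delta_gt0 : 0 < delta by rewrite lt_min heps invr_gt0.
have [N N_gt0 hit] := density_hit _ _ _ hA delta_gt0.
(* Taking [n >= k] meets the size condition in [scale_contained]. *)
exists (maxn N k) => [|n]; first by rewrite leq_max N_gt0.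
rewrite geq_max => /andP[Nn kn].
have n_gt0 : 0 < n%:R :> R by rewrite ltr0n; lia.
have /choice[r rP] : forall i : 'I_(#|` Q|), exists a : int,
    A a /\ `|a%:~R - tau R Q n i| < n%:R * delta.
  move=> i; have [a Aa ai] := hit _ Nn _ (tau_bound R Q n i (ltn_ord i)).
  by exists a.
have r_neq (i j : 'I_(#|` Q|)) : (i < j)%N -> r i <> r j.
  move=> ij rij; have := tau_sep R Q n i j (ltn_ord j) ij; rewrite -/D => sep.
  have D_gt0 : 0 < D%:~R :> R.
    have jk : elt Q j <= elt Q (#|` Q|).-1.
      by apply: elt_le; have := ltn_ord j; lia.
    have ji := elt_mono Q i j (ltn_ord j) ij.
    have i0 : elt Q 0 <= elt Q i by apply: elt_le.
    by rewrite ltr0z /D; lia.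
  (* A common value would force [tau j - tau i < 2 * n * delta <= n / D], against [sep]. *)
  have [[_ +] [_ +]] := (rP i, rP j); rewrite rij !ltr_distl.
  move=> /andP[i1 i2] /andP[j1 j2].
  have : n%:R * delta * 2 <= n%:R / D%:~R.
    rewrite -mulrA ler_wpM2l// -ler_pdivlMr// -invfM.
    rewrite ge_min; apply/orP; right.
    by rewrite lef_pV2 ?posrE//; lra.
  lra.
have r_inj : injective r.
  move=> i j rij; apply/val_inj; case: (ltngtP i j) => //.
    by move=> /r_neq; rewrite rij.
  by move=> /r_neq; rewrite rij.
exists [fset r i | i : 'I_(#|` Q|)]%fset; split.
- by rewrite hQ.
- by rewrite card_imfset//= size_enum_ord.
- by move=> _ /= /imfsetP[i _ ->]; exact: (rP i).1.
- exists r; split => // i; apply: lt_le_trans (rP i).2 _.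
  by rewrite ler_wpM2l// ge_min lexx.
Qed.
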